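(* Let $\alpha,\beta,\gamma,\delta\in\mathbb{C}$ and $I\subseteq\mathbb{R}$ with $\#I\geq 3$ be such that $$w(t)=\frac{\alpha t+\beta}{\gamma t+\delta}\qquad(t\in I)$$ describes (part of) the boundary $\partial K$ of a circle $K$ in $\mathbb{C}$, i.e. $w(I)\subseteq\partial K$, and therefore $$\begin{vmatrix}\gamma&\delta\\ \overline{\gamma}&\overline{\delta}\end{vmatrix}\neq 0\qquad\text{and}\qquad \begin{vmatrix}\alpha&\beta\\ \gamma&\delta\end{vmatrix}\neq 0.$$ Then the circle $K$ has center $m$ and radius $r$ given by $$m=\frac{\begin{vmatrix}\alpha&\beta\\ \overline{\gamma}&\overline{\delta}\end{vmatrix}}{\begin{vmatrix}\gamma&\delta\\ \overline{\gamma}&\overline{\delta}\end{vmatrix}}\qquad\text{and}\qquad r=\left|\frac{\begin{vmatrix}\alpha&\beta\\ \gamma&\delta\end{vmatrix}}{\begin{vmatrix}\gamma&\delta\\ \overline{\gamma}&\overline{\delta}\end{vmatrix}}\right|.$$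
   Context: $\#I$ is the number of elements of $I$. Vertical bars around a $2\times2$ array denote the determinant, $\begin{vmatrix}p&q\\ u&v\end{vmatrix}=pv-qu$; vertical bars around a number denote the modulus; the overline denotes complex conjugation. $\partial K$ is the boundary of the circle (disk) $K$.
   Formalization: The claim that w(I) ⊆ ∂K implies both determinants are nonzero is proved only for w not constant on I; it fails for constant w (e.g. α=γ=0, β=δ=1, w=1 on the unit circle, where both determinants vanish). *)

(* Defs.v *)
From HB Require Import structures.
From mathcomp Require Import all_boot all_order all_algebra.
From mathcomp Require Import complex.
From mathcomp Require Import all_classical all_reals all_analysis.

Set Implicit Arguments.
Unset Strict Implicit.
Unset Printing Implicit Defensive.

Import Order.TTheory GRing.Theory Num.Theory.
Import numFieldNormedType.Exports.

Local Open Scope classical_set_scope.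
Local Open Scope ring_scope.

Definition det2 (A : pzRingType) (p q u v : A) : A := p * v - q * u.

Definition boundary (T : topologicalType) (A : set T) : set T :=
  closure A `\` interior A.

(* R[i]^o carries the topology of the modulus; the norm of R[i] takes its
   values in R[i], so the real radius is embedded with %:C. *)
Definition disk (R : realType) (c : R[i]) (rho : R) : set R[i]^o :=
  [set z : R[i]^o | `|(z : R[i]) - c| <= rho%:C%C].

(* Since x / 0 = 0, this is the intended quotient only where
   gamma t + delta != 0. *)
Definition mobius (R : realType) (alpha beta gamma delta : R[i]) (t : R)
    : R[i] :=
  (alpha * t%:C%C + beta) / (gamma * t%:C%C + delta).

(* Main.v *)
(** Put [a = alpha - c gamma] and [b = beta - c delta]. Three parameters with
    [w(t)] on the circle force the real quadratics [|a t + b|^2] and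
    [rho^2 |gamma t + delta|^2] to coincide. Evaluating this identity at the
    root [- delta / gamma] of the right-hand side (homogeneously, if [gamma = 0]) gives
    [(a delta - b gamma) (a^* delta - b^* gamma) = 0]. Since
    [a delta - b gamma = det2 alpha beta gamma delta], the second factor
    vanishes, which is the formula for the center; substituting back gives
    [|det2 alpha beta gamma delta|^2 = rho^2 |det2 gamma delta gamma^* delta^*|^2],
    which is the formula for the radius and also shows that the second
    determinant cannot vanish. *)

Require Import Defs.
From mathcomp Require Import all_boot all_order all_algebra.
From mathcomp Require Import complex ring.
From mathcomp Require Import all_classical all_reals all_analysis.

Import Order.TTheory GRing.Theory Num.Theory.
Import numFieldNormedType.Exports.

Local Open Scope classical_set_scope.
Local Open Scope ring_scope.

(** If [|z - c|] and [rho] differ, the ball around [z] whose radius is their gap misses the disk or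
    lies inside it. *)
Lemma boundary_disk_norm {R : realType} (c : R[i]) (rho : R) (z : R[i]) :
  boundary (disk c rho) z -> `|z - c| = rho%:C%C.
Proof.
have rhoR : rho%:C%C \is Num.real by rewrite complex_real.
move=> [clz nintz]; apply/eqP; rewrite eq_le; apply/andP; split.
  rewrite real_leNgt ?normr_real//; apply/negP => lt_rho.
  have e0 : 0 < `|z - c| - rho%:C%C by rewrite subr_gt0.
  have [y [/= yrho]] := clz _ (nbhsx_ballx (z : R[i]^o) _ e0).
  rewrite /ball /= => yz.
  have := ler_ltD yrho yz.
  rewrite [ltRHS]addrC subrK addrC; apply/negP; rewrite -real_leNgt ?normr_real ?realD ?normr_real//.
  by rewrite (le_trans _ (ler_normD _ _))// addrA subrK.
rewrite real_leNgt ?normr_real//; apply/negP => lt_rho.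
apply: nintz.
have e0 : 0 < rho%:C%C - `|z - c| by rewrite subr_gt0.
apply: filterS (nbhsx_ballx (z : R[i]^o) _ e0) => y; rewrite /ball /disk /= => yz.
have : `|y - c| <= `|z - y| + `|z - c|.
  by rewrite -(distrC y z) (le_trans _ (ler_normD _ _))// addrA subrK.
by move=> /le_trans; apply; rewrite -lerBrDr ltW.
Qed.

Lemma card_ge3_distinct {T : pointedType} (A : set T) :
  (`I_3 #<= A)%card ->
  exists x y z, [/\ A x, A y & A z] /\ [/\ x <> y, x <> z & y <> z].
Proof.
move=> /pcard_leP[f]; exists (f 0%N), (f 1%N), (f 2%N).
by split; split; try exact: (@funS _ _ _ _ f);
  move=> /(@inj _ _ _ f); rewrite !inE => /(_ isT isT).
Qed.

Lemma quadratic_three_roots {F : fieldType} (p q r x y z : F) :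
  x != y -> x != z -> y != z ->
  p * x ^+ 2 + q * x + r = 0 -> p * y ^+ 2 + q * y + r = 0 ->
  p * z ^+ 2 + q * z + r = 0 ->
  [/\ p = 0, q = 0 & r = 0].
Proof.
rewrite -subr_eq0 => xy; rewrite -subr_eq0 => xz; rewrite -subr_eq0 => yz ex ey ez.
(* Divided differences: two equations subtract to a multiple of the difference of the nodes;
   repeating this isolates [p]. *)
have exy : p * (x + y) + q = 0.
  apply: (mulfI xy); rewrite mulr0 -(subrr 0) -{1}ex -ey; ring.
have exz : p * (x + z) + q = 0.
  apply: (mulfI xz); rewrite mulr0 -(subrr 0) -{1}ex -ez; ring.
have p0 : p = 0.
  apply: (mulfI yz); rewrite mulr0 -(subrr 0) -{1}exy -exz; ring.
have q0 : q = 0 by rewrite -exy p0; ring.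
by split=> //; rewrite -ex p0 q0; ring.
Qed.

(* The primed variables stand for complex conjugates and [k] for [rho ^+ 2]. *)
Lemma hermitian_quadratic_eq {F : fieldType} (a a' b b' g g' d d' k : F) :
  a * a' = k * (g * g') -> b * b' = k * (d * d') ->
  a * b' + a' * b = k * (g * d' + g' * d) ->
  (a * d - b * g) * (a' * d - b' * g) = 0.
Proof.
move=> eaa ebb eab.
(* The product is the form [(a X + b Y) * (a' X + b' Y)] at the zero [(d, - g)] of [g X + d Y]. *)
transitivity (a * a' * d ^+ 2 - (a * b' + a' * b) * (g * d) + b * b' * g ^+ 2).
  ring.
by rewrite eaa ebb eab; ring.
Qed.

Lemma hermitian_quadratic_det {F : fieldType} (a a' b b' g g' d d' k : F) :
  a * a' = k * (g * g') -> b * b' = k * (d * d') ->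
  a * b' + a' * b = k * (g * d' + g' * d) ->
  a * d' = b * g' -> a' * d = b' * g ->
  (a * d - b * g) * (a' * d' - b' * g') =
  k * ((g * d' - d * g') * (g' * d - d' * g)).
Proof.
move=> eaa ebb eab e e'.
(* The hypotheses fix only the sum [a * b' + a' * b]; [e] and [e'] separate its two terms without
   dividing, so [g = 0] is no special case. *)
have E1 : a * b' * (g' * d) = k * (g' * d) ^+ 2.
  transitivity ((a * b' + a' * b) * (g' * d) - a' * d * (b * g')); first by ring.
  rewrite eab -e.
  transitivity (k * (g * d' + g' * d) * (g' * d) - a * a' * (d * d')); first by ring.
  by rewrite eaa; ring.
have E2 : a' * b * (g * d') = k * (g * d') ^+ 2.
  transitivity ((a * b' + a' * b) * (g * d') - a * d' * (b' * g)); first by ring.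
  rewrite eab -e'.
  transitivity (k * (g * d' + g' * d) * (g * d') - a * a' * (d * d')); first by ring.
  by rewrite eaa; ring.
transitivity (a * a' * (d * d') - a * b' * (g' * d) - a' * b * (g * d')
              + b * b' * (g * g')); first by ring.
by rewrite eaa ebb E1 E2; ring.
Qed.

(** Both formulas are kept free of quotients, so that the radius identity can itself be used to
    prove the denominator nonzero. *)
Lemma mobius_circle_center_radius {R : realType} (alpha beta gamma delta : R[i])
    (I : set R) (c : R[i]) (rho : R) :
  (`I_3 #<= I)%card ->
  (forall t : R, I t -> gamma * t%:C%C + delta != 0) ->
  (forall t : R, I t -> `|mobius alpha beta gamma delta t - c| = rho%:C%C) ->
  det2 alpha beta gamma delta != 0 ->
  c * det2 gamma delta (gamma^*)%C (delta^*)%C =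
    det2 alpha beta (gamma^*)%C (delta^*)%C /\
  `|det2 alpha beta gamma delta| ^+ 2 =
    rho%:C%C ^+ 2 * `|det2 gamma delta (gamma^*)%C (delta^*)%C| ^+ 2.
Proof.
move=> /card_ge3_distinct[x [y [z [[Ix Iy Iz] [nxy nxz nyz]]]]] hdef hw hD.
pose a := alpha - c * gamma; pose b := beta - c * delta.
pose k := rho%:C%C ^+ 2.
have conj_affine (u v : R[i]) (t : R) :
    (u * t%:C%C + v)^*%C = u^*%C * t%:C%C + v^*%C.
  by rewrite rmorphD rmorphM /= oppr0.
have quad t : I t ->
    (a * a^*%C - k * (gamma * gamma^*%C)) * t%:C%C ^+ 2 +
    (a * b^*%C + a^*%C * b
      - k * (gamma * delta^*%C + gamma^*%C * delta)) * t%:C%C +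
    (b * b^*%C - k * (delta * delta^*%C)) = 0.
  move=> It.
  have gd := hdef _ It.
  (* Here [w(t) - c = (a t + b) / (gamma t + delta)]. *)
  have e : `|a * t%:C%C + b| ^+ 2 = k * `|gamma * t%:C%C + delta| ^+ 2.
    rewrite -exprMn -(hw _ It) -normrM; congr (`|_| ^+ 2).
    by rewrite [RHS]mulrBl /mobius divfK// /a /b; ring.
  move: e; rewrite !sqr_normc !conj_affine => e.
  rewrite -(subrr (k * ((gamma * t%:C%C + delta)
     * (gamma^*%C * t%:C%C + delta^*%C)))) -{1}e; ring.
have neqC (s t : R) : s <> t -> s%:C%C != t%:C%C.
  by move=> st; apply/eqP => -[].
have [/subr0_eq eaa /subr0_eq eab /subr0_eq ebb] := quadratic_three_roots
  _ _ _ _ _ _ (neqC _ _ nxy) (neqC _ _ nxz) (neqC _ _ nyz)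
  (quad _ Ix) (quad _ Iy) (quad _ Iz).
have Dab : det2 alpha beta gamma delta = a * delta - b * gamma.
  by rewrite /det2 /a /b; ring.
have e' : a^*%C * delta = b^*%C * gamma.
  have /eqP := hermitian_quadratic_eq _ _ _ _ _ _ _ _ _ eaa ebb eab.
  by rewrite -Dab mulf_eq0 (negbTE hD) /= subr_eq0 => /eqP.
have e : a * delta^*%C = b * gamma^*%C.
  by have := congr1 (@conjc R) e'; rewrite !rmorphM /= !conjcK.
split.
  (* The difference of the two sides is [a * delta^* - b * gamma^*], which is zero by [e]. *)
  apply/eqP; rewrite eq_sym -subr_eq0 -(subrr (b * gamma^*%C)) -{1}e.
  by apply/eqP; rewrite /det2 /a /b; ring.
rewrite Dab !sqr_normc /det2 !rmorphB !rmorphM /= !conjcK.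
exact: (hermitian_quadratic_det _ _ _ _ _ _ _ _ _ eaa ebb eab e e').
Qed.

(** A constant [w] can also take its value on the circle, with first determinant zero; hence
    nonvanishing is derived from two distinct values of [w]. *)
Theorem lemma2p1 (R : realType) (alpha beta gamma delta : R[i]) (I : set R)
    (c : R[i]) (rho : R)
    (hI : (`I_3 #<= I)%card)
    (hdef : forall t : R, I t -> gamma * t%:C%C + delta != 0)
    (hrho : 0 < rho)
    (hw : mobius alpha beta gamma delta @` I `<=` boundary (disk c rho)) :
  ((exists s t : R, [/\ I s, I t &
      mobius alpha beta gamma delta s != mobius alpha beta gamma delta t]) ->
    det2 gamma delta (gamma^*)%C (delta^*)%C != 0 /\
    det2 alpha beta gamma delta != 0)
  /\
  (det2 gamma delta (gamma^*)%C (delta^*)%C != 0 ->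
   det2 alpha beta gamma delta != 0 ->
   c = det2 alpha beta (gamma^*)%C (delta^*)%C
       / det2 gamma delta (gamma^*)%C (delta^*)%C /\
   rho%:C%C = `|det2 alpha beta gamma delta
                / det2 gamma delta (gamma^*)%C (delta^*)%C|).
Proof.
have hnorm t : I t -> `|mobius alpha beta gamma delta t - c| = rho%:C%C.
  by move=> It; apply: boundary_disk_norm; apply: hw; exists t.
have main := mobius_circle_center_radius _ _ _ _ _ _ _ hI hdef hnorm.
split.
  move=> [s [t [Is It nst]]].
  have D0 : det2 alpha beta gamma delta != 0.
    (* The numerator of [w(s) - w(t)] is the determinant times [s - t]. *)
    apply: contraNneq nst => D0; apply/eqP; rewrite /mobius.
    apply/eqP; rewrite eqr_div ?hdef// -subr_eq0; apply/eqP.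
    transitivity (det2 alpha beta gamma delta * (s%:C%C - t%:C%C)).
      by rewrite /det2; ring.
    by rewrite D0 mul0r.
  split=> //; have [_ eD] := main D0.
  apply: contraNneq D0 => E0; move: eD; rewrite E0 normr0 expr0n mulr0 => /eqP.
  by rewrite sqrf_eq0 normr_eq0.
move=> E0 D0; have [ec eD] := main D0; split.
  by rewrite -ec mulfK.
have rho0 : 0 <= rho%:C%C by rewrite ler0c ltW.
(* Both sides are nonnegative, so comparing squares suffices. *)
apply/eqP; rewrite -(@eqrXn2 _ 2)// normf_div expr_div_n eD mulfK//.
by rewrite sqrf_eq0 normr_eq0.
Qed.
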